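(* Let $G$ be a graph of order $n$ such that $\gamma_2(G)\ge 2$. Then $st_{\gamma_2}(G)\le n-\gamma_2(G)+1$.
   Context: All graphs are finite, simple and undirected. For a graph $G=(V,E)$, a subset $D \subseteq V$ is a 2-dominating set if every vertex $v \in V \setminus D$ has at least two neighbors in $D$. The 2-domination number $\gamma_2(G)$ is the minimum cardinality of a 2-dominating set of $G$. The stability of the 2-domination number, $st_{\gamma_2}(G)$, is the minimum number of vertices whose removal from $G$ (deleting the vertices and all incident edges) changes the 2-domination number, i.e. the minimum of $|S|$ over $S\subseteq V$ with $\gamma_2(G-S)\ne\gamma_2(G)$. *)

(* Defs.v *)
From mathcomp Require Import all_boot.

Set Implicit Arguments.
Unset Strict Implicit.
Unset Printing Implicit Defensive.

Record sgraph := SGraph {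
  vertex :> finType;
  adj : rel vertex;
  adj_sym : symmetric adj;
  adj_irrefl : irreflexive adj
}.

Definition neighbors (G : sgraph) (v : G) : {set G} := [set u | adj v u].

Definition two_dominating (G : sgraph) (D : {set G}) : bool :=
  [forall v, (v \notin D) ==> (2 <= #|neighbors v :&: D|)].

Lemma two_dominating_setT (G : sgraph) : two_dominating [set: G].
Proof. by apply/forallP => v; rewrite in_setT. Qed.

Definition gamma2 (G : sgraph) : nat :=
  #|[arg min_(D < [set: G] | two_dominating D) #|D|]|.

Lemma gamma2_attained (G : sgraph) :
  exists2 D : {set G}, two_dominating D & #|D| = gamma2 G.
Proof.
by rewrite /gamma2; case: arg_minnP => [|D hD _];
  [exact: two_dominating_setT | exists D].
Qed.

Lemma gamma2_min (G : sgraph) (D : {set G}) :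
  two_dominating D -> gamma2 G <= #|D|.
Proof.
by rewrite /gamma2; case: arg_minnP => [|D' _ hmin];
  [exact: two_dominating_setT | exact: hmin].
Qed.

Lemma gamma2_le_order (G : sgraph) : gamma2 G <= #|G|.
Proof. by rewrite -cardsT; exact/gamma2_min/two_dominating_setT. Qed.

Definition del_adj (G : sgraph) (S : {set G}) : rel {v : G | v \notin S} :=
  fun u v => adj (val u) (val v).

Lemma del_adj_sym (G : sgraph) (S : {set G}) : symmetric (@del_adj G S).
Proof. by move=> u v; exact: adj_sym. Qed.

Lemma del_adj_irrefl (G : sgraph) (S : {set G}) : irreflexive (@del_adj G S).
Proof. by move=> u; exact: adj_irrefl. Qed.

Definition del_vertices (G : sgraph) (S : {set G}) : sgraph :=
  SGraph (@del_adj_sym G S) (@del_adj_irrefl G S).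

Definition changes_gamma2 (G : sgraph) (S : {set G}) : bool :=
  gamma2 (del_vertices S) != gamma2 G.

(* S ranges over all subsets of the vertex set, the whole vertex set included;
   the empty graph has gamma2 = 0.  The default [set: G] of the arg min is a
   valid candidate as soon as gamma2 G > 0, i.e. as soon as G has a vertex. *)
Definition st_gamma2 (G : sgraph) : nat :=
  #|[arg min_(S < [set: G] | changes_gamma2 S) #|S|]|.

Lemma changes_gamma2_setT (G : sgraph) :
  0 < gamma2 G -> changes_gamma2 [set: G].
Proof.
move=> G_gt0; rewrite /changes_gamma2 neq_ltn; apply/orP; left.
apply: leq_ltn_trans (gamma2_le_order _) _.
by rewrite eq_card0 // => -[x hx]; exfalso; move: hx; rewrite in_setT.
Qed.

Lemma st_gamma2_attained (G : sgraph) : 0 < gamma2 G ->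
  exists2 S : {set G}, changes_gamma2 S & #|S| = st_gamma2 G.
Proof.
move=> G_gt0; rewrite /st_gamma2; case: arg_minnP => [|S hS _].
  exact: changes_gamma2_setT.
by exists S.
Qed.

Lemma st_gamma2_min (G : sgraph) (S : {set G}) : 0 < gamma2 G ->
  changes_gamma2 S -> st_gamma2 G <= #|S|.
Proof.
move=> G_gt0; rewrite /st_gamma2; case: arg_minnP => [|S' _ hmin].
  exact: changes_gamma2_setT.
exact: hmin.
Qed.

(* Main.v *)
Require Import Defs.
From mathcomp Require Import all_boot.

(** The 2-domination number never exceeds the order, so deleting vertices until fewer than
    [gamma2 G] remain forces it to drop ([changes_gamma2_small_order]). Any set of
    [n - gamma2 G + 1] vertices does this, whatever the edges are. *)

Lemma card_del_vertices (G : sgraph) (S : {set G}) :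
  #|del_vertices S| = #|G| - #|S|.
Proof.
(* [S] becomes [~: ~: S], so that [cardsCs] folds the difference into the size of [~: S]. *)
by rewrite /= card_sig -[in RHS](setCK S) -cardsCs; apply: eq_card => v; rewrite !inE.
Qed.

Lemma changes_gamma2_small_order (G : sgraph) (S : {set G}) :
  #|G| - #|S| < gamma2 G -> changes_gamma2 S.
Proof.
move=> small; rewrite /changes_gamma2 neq_ltn; apply/orP; left.
by apply: leq_ltn_trans (gamma2_le_order _) _; rewrite card_del_vertices.
Qed.

Theorem theorem3p6 (G : sgraph) (n : nat) (hn : #|G| = n)
    (hG : 2 <= gamma2 G) :
  st_gamma2 G <= n - gamma2 G + 1.
Proof.
have G_gt0 : 0 < gamma2 G by apply: ltnW.
have le_n : gamma2 G <= n by rewrite -hn gamma2_le_order.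
(* [G] has enough vertices to delete, since [gamma2 G] is positive. *)
have : n - gamma2 G + 1 <= #|G|.
  by rewrite hn addn1 ltn_subrL G_gt0 (leq_trans G_gt0).
case/card_geqP=> s [uniq_s size_s _].
have cardS : #|[set:: s]| = n - gamma2 G + 1.
  by rewrite cardsE (card_uniqP uniq_s).
rewrite -cardS; apply: st_gamma2_min => //; apply: changes_gamma2_small_order.
(* Exactly [gamma2 G - 1] vertices survive; [le_n] keeps the truncated subtraction exact. *)
by rewrite hn cardS subnDA subKn // subn1 ltn_predL.
Qed.
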